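(* Topological spaces $X$ and $Y$ are $L$-equivalent if and only if there is a topological isomorphism $\varphi: C_p(X)\to C_p(Y)$ such that both $\varphi$ and $\varphi^{-1}$ preserve equicontinuous pointwise bounded sets.
   Context: All topological spaces are Tychonoff; all locally convex spaces are real and Hausdorff. $C(X)$ is the set of continuous real functions on $X$ and $C_p(X)$ is $C(X)$ with the topology of pointwise convergence. ''Topological isomorphism'' means linear homeomorphism. A continuous linear mapping $\varphi: C_p(Y)\to C_p(X)$ preserves equicontinuous pointwise bounded sets if for every equicontinuous pointwise bounded set $A\subset C(Y)$ the image $\varphi(A)$ is an equicontinuous pointwise bounded subset of $C(X)$. The free locally convex space $L(X)$ over $X$ is a locally convex space with a continuous injection $\delta_X: X\to L(X)$ such that $L(X)$ is the linear span of $\delta_X(X)$ and every continuous $f: X\to E$ to a locally convex space $E$ satisfies $f=f_\#\circ\delta_X$ for a (unique) continuous linear $f_\#: L(X)\to E$. It exists and is unique up to topological isomorphism. Spaces $X$ and $Y$ are $L$-equivalent if $L(X)$ and $L(Y)$ are topologically isomorphic. *)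

(* Defs.v *)
From HB Require Import structures.
From mathcomp Require Import all_boot all_order all_algebra.
From mathcomp Require Import all_classical all_reals all_analysis.

Set Implicit Arguments.
Unset Strict Implicit.
Unset Printing Implicit Defensive.

Import Order.TTheory GRing.Theory Num.Theory.
Import numFieldNormedType.Exports.

Local Open Scope classical_set_scope.
Local Open Scope ring_scope.

Definition tychonoff_space (X : topologicalType) : Prop :=
  completely_regular_space X /\ hausdorff_space X.

(* [continuousType X R] carries no algebraic structure and no default topology
   in the library; the alias [Cp X R] equips it with the pointwise vector space
   operations and the topology of pointwise convergence. *)
Definition Cp (X : topologicalType) (R : realType) : Type := continuousType X R.

Section Cp_structure.
Context {X : topologicalType} {R : realType}.
Local Notation C := (Cp X R).

Definition Cp_fun (f : C) : X -> R := (f : continuousType X R).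

HB.instance Definition _ := Choice.copy C (continuousType X R).
HB.instance Definition _ :=
  Topological.copy C (initial_topology (Cp_fun : C -> {ptws X -> R})).

Let Cp_continuous (f : C) : continuous (Cp_fun f).
Proof. exact: (@cts_fun _ _ (f : continuousType X R)). Qed.

Definition Cp_mk (f : X -> R) (cf : continuous f) : C :=
  (mkcts cf : continuousType X R).

Lemma Cp_addP (f g : C) : continuous (fun x => Cp_fun f x + Cp_fun g x).
Proof. by move=> x; apply: cvgD; exact: Cp_continuous. Qed.
Lemma Cp_oppP (f : C) : continuous (fun x => - Cp_fun f x).
Proof. by move=> x; apply: cvgN; exact: Cp_continuous. Qed.
Lemma Cp_scaleP (a : R) (f : C) : continuous (fun x => a * Cp_fun f x).
Proof. by move=> x; apply: cvgMl_tmp; exact: Cp_continuous. Qed.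
Lemma Cp_zeroP : continuous (fun _ : X => 0 : R).
Proof. by move=> x; exact: cvg_cst. Qed.

Definition Cp_zero : C := Cp_mk Cp_zeroP.
Definition Cp_add (f g : C) : C := Cp_mk (@Cp_addP f g).
Definition Cp_opp (f : C) : C := Cp_mk (@Cp_oppP f).
Definition Cp_scale (a : R) (f : C) : C := Cp_mk (@Cp_scaleP a f).

Lemma CpP (f g : C) : Cp_fun f =1 Cp_fun g -> f = g.
Proof. by move=> fg; apply/continuousEP. Qed.

Let addA : associative Cp_add.
Proof. by move=> f g h; apply: CpP => x; exact: addrA. Qed.
Let addC : commutative Cp_add.
Proof. by move=> f g; apply: CpP => x; exact: addrC. Qed.
Let add0 : left_id Cp_zero Cp_add.
Proof. by move=> f; apply: CpP => x; exact: add0r. Qed.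
Let addN : left_inverse Cp_zero Cp_opp Cp_add.
Proof. by move=> f; apply: CpP => x; exact: addNr. Qed.

HB.instance Definition _ := GRing.isZmodule.Build C addA addC add0 addN.

Let scaleA a b (f : C) : Cp_scale a (Cp_scale b f) = Cp_scale (a * b) f.
Proof. by apply: CpP => x; exact: mulrA. Qed.
Let scale1 : left_id 1 Cp_scale.
Proof. by move=> f; apply: CpP => x; exact: mul1r. Qed.
Let scaleDr : right_distributive Cp_scale +%R.
Proof. by move=> a f g; apply: CpP => x; exact: mulrDr. Qed.
Let scaleDl (f : C) : {morph Cp_scale^~ f : a b / a + b}.
Proof. by move=> a b; apply: CpP => x; exact: mulrDl. Qed.

HB.instance Definition _ :=
  GRing.Zmodule_isLmodule.Build R C scaleA scale1 scaleDr scaleDl.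

End Cp_structure.

Coercion Cp_fun : Cp >-> Funclass.

Definition topological_isomorphism (R : realType)
    (E F : preTopologicalLmodType R)
    (phi : {linear E -> F}) (psi : {linear F -> E}) : Prop :=
  [/\ cancel phi psi, cancel psi phi, continuous phi & continuous psi].

Definition equicontinuous_pointwise_bounded (X : topologicalType)
    (R : realType) (A : set (Cp X R)) : Prop :=
  equicontinuous A Cp_fun /\
  forall x, bounded_set [set (f : Cp X R) x | f in A].

Definition preserves_equicontinuous_pointwise_bounded (X Y : topologicalType)
    (R : realType) (phi : Cp X R -> Cp Y R) : Prop :=
  forall A : set (Cp X R), equicontinuous_pointwise_bounded A ->
    equicontinuous_pointwise_bounded (phi @` A).

Definition free_locally_convex_space (R : realType) (X : topologicalType)
    (L : tvsType R) (delta : X -> L) : Prop :=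
  [/\ hausdorff_space L,
      continuous delta,
      injective delta,
      forall v : L, exists s : seq (R * X),
        v = \sum_(p <- s) p.1 *: delta p.2 &
      forall (E : tvsType R) (f : X -> E), hausdorff_space E -> continuous f ->
        exists! g : L -> E, [/\ linear g, continuous g & f = g \o delta]].

(* The spaces L(X) and L(Y), unique only up to topological isomorphism, are
   given by any two models of the universal property; since both models are
   quantified existentially, the relation cannot hold vacuously. *)
Definition L_equivalent (R : realType) (X Y : topologicalType) : Prop :=
  exists (LX LY : tvsType R) (dX : X -> LX) (dY : Y -> LY),
    [/\ free_locally_convex_space dX,
        free_locally_convex_space dY &
        exists (phi : {linear LX -> LY}) (psi : {linear LY -> LX}),
          topological_isomorphism phi psi].

(* Main.v *)
From HB Require Import structures.
Require Import Defs.
From mathcomp Require Import all_boot all_order all_algebra.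
From mathcomp Require Import all_classical all_reals all_analysis.
From mathcomp Require Import ring lra.

Set Implicit Arguments.
Unset Strict Implicit.
Unset Printing Implicit Defensive.

Import Order.TTheory GRing.Theory Num.Theory.
Import numFieldNormedType.Exports.

Local Open Scope classical_set_scope.
Local Open Scope ring_scope.

(** Write EPB for the equicontinuous pointwise bounded subsets of [Cp X R]. The
    free locally convex space over X has a concrete model: the span of the point
    evaluations inside the algebraic dual of C(X), with the topology of uniform
    convergence on the EPB sets ([point_span], [point_span_free]). Granted this,
    both directions are transposition.

    Why the model is free. A map f from X to a Hausdorff locally convex space E
    has only one candidate extension, sending a combination of evaluations to
    the same combination of values of f. A continuous functional u of E turns f
    into the function u o f of C(X), so u of the extension at mu is mu (u o f)
    ([functional_extension]); as functionals separate points, the extension is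
    well defined and linear. For continuity, let V be a neighbourhood of 0 in E.
    The bipolar theorem ([locally_convex_separation]) gives a neighbourhood W of
    0 such that every vector outside V is sent to at least 1 by some functional
    bounded by 1 on W. The functions u o f, for u bounded by 1 on W, form an EPB
    set, and a mu that is at most 1/2 on that set is mapped into V. Separation
    rests on [Hahn_Banach] applied to the gauge of a convex neighbourhood.

    From an isomorphism of free spaces to one of function spaces. A continuous
    map k from Y to [point_span X R] induces the linear map from C(X) to C(Y)
    that sends h to y |-> k y h. It is continuous since each k y is a
    combination of evaluations, and it preserves EPB sets because continuity of
    k says exactly that the image of an EPB set is equicontinuous
    ([induced_map_bounded]). An isomorphism between any two models of L(X) and
    L(Y) provides such a k in each direction, and the induced maps are mutually
    inverse by [induced_map_pairing].

    From function spaces to free spaces. A continuous linear phi from Cp(Y) to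
    Cp(X) has a transpose from [point_span X R] to [point_span Y R], because a
    continuous functional on Cp(Y) is a combination of evaluations
    ([continuous_functional_combination]). The transpose is continuous as soon
    as phi preserves EPB sets ([transpose_continuous]). *)

(** * The Hahn-Banach theorem *)

Section HahnBanach.
Context (R : realType) (V : lmodType R) (p : V -> R).
Hypothesis p_subadditive : forall u v, p (u + v) <= p u + p v.
Hypothesis p_homogeneous : forall a v, 0 < a -> p (a *: v) = a * p v.

Let p0 : p 0 = 0.
Proof. by have := @p_homogeneous 2 0 (ltr0n R 2); rewrite scaler0; lra. Qed.

(** A linear functional defined on a subspace and bounded by p, encoded by its
    graph so that the union of a chain is again of this form. Single-valuedness
    is a consequence: if (0, r) is in the graph, so is (0, - r), and both r and
    - r are at most p 0 = 0. *)
Definition dominated_graph (G : set (V * R)) : Prop :=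
  (forall a x y r s, G (x, r) -> G (y, s) -> G (a *: x + y, a * r + s)) /\
  (forall x r, G (x, r) -> r <= p x).

(** The value c at the new vector v must satisfy r - p (x - v) <= c for (x, r)
    in the graph and c <= p (y + v) - s for (y, s) in it. Subadditivity of p makes
    every left-hand side at most every right-hand side, so the supremum of the
    left-hand sides works; homogeneity then covers all multiples of v. *)
Lemma dominated_graph_extend (G : set (V * R)) (v : V) :
  dominated_graph G -> G (0, 0) ->
  exists c, dominated_graph
    [set z | exists x r t, G (x, r) /\ z = (x + t *: v, r + t * c)].
Proof.
move=> [Glin Gdom] G0.
have GZ a x r : G (x, r) -> G (a *: x, a * r).
  by move=> Gx; have := Glin a _ _ _ _ Gx G0; rewrite !addr0.
pose S := [set y | exists x r, G (x, r) /\ y = r - p (x - v)].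
have Sub x r : G (x, r) -> ubound S (p (x + v) - r).
  move=> Gx _ [x' [r' [Gx' ->]]].
  have := Gdom _ _ (Glin 1 _ _ _ _ Gx Gx'); rewrite scale1r mul1r.
  have := p_subadditive (x + v) (x' - v).
  by rewrite addrACA subrr addr0; lra.
have S0 : S (- p (- v)) by exists 0, 0; split=> //; rewrite !sub0r.
have cub x r : G (x, r) -> r + sup S <= p (x + v).
  move=> Gx; suff : sup S <= p (x + v) - r by lra.
  by apply: ge_sup; [exists (- p (- v))|exact: Sub].
have clb x r : G (x, r) -> r - sup S <= p (x - v).
  move=> Gx; suff : r - p (x - v) <= sup S by lra.
  apply: ub_le_sup; last by exists x, r.
  by exists (p (0 + v) - 0); exact: Sub.
exists (sup S); split.
  move=> a _ _ _ _ [x [r [t [Gx [-> ->]]]]] [y [s [t' [Gy [-> ->]]]]].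
  exists (a *: x + y), (a * r + s), (a * t + t'); split; first exact: Glin.
  congr pair; last by ring.
  by rewrite scalerDr scalerA scalerDl addrACA.
move=> _ _ [x [r [t [Gx [-> ->]]]]].
have [t0|t0|->] := ltgtP t 0; last by rewrite scale0r mul0r !addr0; exact: Gdom.
- have t'0 : 0 < - t by rewrite oppr_gt0.
  have := clb _ _ (GZ (- t)^-1 _ _ Gx).
  rewrite -(ler_pM2l t'0) -p_homogeneous// scalerBr scalerA mulrBr mulrA.
  by rewrite divff ?gt_eqF// scale1r mul1r scaleNr opprK mulNr opprK.
- have := cub _ _ (GZ t^-1 _ _ Gx).
  rewrite -(ler_pM2l t0) -p_homogeneous// scalerDr scalerA mulrDr mulrA.
  by rewrite divff ?gt_eqF// scale1r mul1r.
Qed.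

(** Zorn's lemma on dominated graphs. The empty graph is admitted, being the
    union of the empty chain; the others must contain the line L through
    (w, p w), so that the maximal one takes the value p w at w. *)
Theorem Hahn_Banach (w : V) : exists u : {linear V -> R^o},
  (forall v, u v <= p v) /\ u w = p w.
Proof.
pose L := [set z : V * R | exists t, z = (t *: w, t * p w)].
have Ldom : dominated_graph L.
  split.
    move=> a _ _ _ _ [t [-> ->]] [s [-> ->]]; exists (a * t + s).
    by rewrite scalerA -scalerDl mulrDl mulrA.
  move=> _ _ [t [-> ->]]; have [t0|t0|->] := ltgtP t 0.
  - have := p_subadditive (t *: w) (- t *: w).
    rewrite (@p_homogeneous (- t)) ?oppr_gt0// -scalerDl subrr scale0r p0.
    lra.
  - by rewrite p_homogeneous.
  - by rewrite scale0r mul0r p0.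
have [G [[Gdom LG] Gmax]] : exists G,
    (dominated_graph G /\ (G !=set0 -> L `<=` G)) /\
    forall H, G `<` H -> ~ (dominated_graph H /\ (H !=set0 -> L `<=` H)).
  apply: (@Zorn_bigcup _
    (fun G => dominated_graph G /\ (G !=set0 -> L `<=` G))).
  move=> F FP Ftot; split; first split.
  - move=> a x y r s [G1 FG1 G1x] [G2 FG2 G2y].
    have [G12|G21] := Ftot _ _ FG1 FG2.
      by exists G2 => //; apply: (FP _ FG2).1.1 => //; exact: G12.
    by exists G1 => //; apply: (FP _ FG1).1.1 => //; exact: G21.
  - by move=> x r [G FG Gx]; exact: (FP _ FG).1.2 Gx.
  - move=> [z [G FG Gz]] l Ll; exists G => //.
    by apply: (FP _ FG).2 => //; exists z.
have {LG} LG : L `<=` G.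
  apply: LG; apply: contrapT => /nonemptyPn G0; apply: (Gmax L); first last.
    by split; [exact: Ldom|move=> _; exact: subset_refl].
  rewrite G0; split; first exact: sub0set.
  by move=> /(_ (0 *: w, 0 * p w)); apply; exists 0.
have G0 : G (0, 0) by apply: LG; exists 0; rewrite scale0r mul0r.
have [Glin Gle] := Gdom.
have Gtot v : exists r, G (v, r).
  have [c cdom] := dominated_graph_extend v Gdom G0.
  apply: contrapT => nGv; apply: (Gmax _ _ (conj cdom _)).
    split.
      by move=> [x r] Gx; exists x, r, 0; rewrite scale0r mul0r !addr0.
    move=> /(_ (v, c)) Gv; apply: nGv; exists c; apply: Gv.
    by exists 0, 0, 1; rewrite scale1r mul1r !add0r.
  by move=> _ [x r] /LG Gx; exists x, r, 0; rewrite scale0r mul0r !addr0.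
have Gfun v r s : G (v, r) -> G (v, s) -> r = s.
  move=> Gr Gs; apply/eqP; rewrite eq_le; apply/andP; split.
    have := Gle _ _ (Glin (-1) _ _ _ _ Gs Gr).
    by rewrite scaleN1r addNr p0; lra.
  have := Gle _ _ (Glin (-1) _ _ _ _ Gr Gs).
  by rewrite scaleN1r addNr p0; lra.
pose u v := sval (cid (Gtot v)).
have Gu v : G (v, u v) by exact: svalP (cid (Gtot v)).
have ulin : linear (u : V -> R^o).
  by move=> a x y; apply: (Gfun _ _ _ (Gu _)); exact: Glin.
pose uL := GRing.isLinear.Build _ _ _ _ (u : V -> R^o) ulin.
pose ul : {linear V -> R^o} := HB.pack (u : V -> R^o) uL.
exists ul; split=> [v|/=]; first exact: Gle.
by apply: (Gfun w) => //; apply: LG; exists 1; rewrite scale1r mul1r.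
Qed.

End HahnBanach.

(** * Separation in locally convex spaces *)

Lemma convex_setP (R : realType) (V : lmodType R) (U : set V) :
  convex_set U <-> forall x y (t : R), U x -> U y -> 0 <= t <= 1 ->
    U (t *: x + (1 - t) *: y).
Proof.
split=> [Ucvx x y t Ux Uy /andP[t0 t1]|Ucvx x y t /set_mem Ux /set_mem Uy].
  by have /set_mem := Ucvx x y (Itv01 t0 t1) (mem_set Ux) (mem_set Uy).
by apply/mem_set; apply: Ucvx => //; apply/andP; split.
Qed.

Section LocallyConvexSeparation.
Context (R : realType) (E : tvsType R).
Implicit Types (U V W : set E) (v w : E).

Lemma nbhs0_absorbing U v : nbhs 0 U -> exists2 t : R, 0 < t & U (t^-1 *: v).
Proof.
move=> U0.
have := @scale_continuous R E (0, v) U; rewrite /= scale0r => /(_ U0).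
move=> [[A B] /= [/nbhs_ballP[e /= e0 eA] Bv] AB].
exists (e / 2)^-1; first by rewrite invr_gt0 divr_gt0.
apply: (AB ((e / 2)^-1^-1, v)); split=> /=; last exact: nbhs_singleton.
rewrite invrK; apply: eA.
rewrite -ball_normE/= sub0r normrN gtr0_norm ?divr_gt0//.
by rewrite ltr_pdivrMr// ltr_pMr// ltr1n.
Qed.

Definition gauge U v : R := inf [set t : R | 0 < t /\ U (t^-1 *: v)].

Section gauge.
Context (U : set E) (Unbhs : nbhs 0 U) (Ucvx : convex_set U).

Let gset v := [set t : R | 0 < t /\ U (t^-1 *: v)].

Let gset_lb v : has_lbound (gset v).
Proof. by exists 0 => t [/ltW]. Qed.

Let gset_neq0 v : gset v !=set0.
Proof. by have [t t0 Ut] := nbhs0_absorbing v Unbhs; exists t. Qed.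

Lemma gauge_le v (t : R) : 0 < t -> U (t^-1 *: v) -> gauge U v <= t.
Proof. by move=> t0 Uv; apply: ge_inf => //; exact: (gset_lb v). Qed.

(** If s^-1 v and t^-1 w lie in U, then (s + t)^-1 (v + w) is their convex
    combination with weights s / (s + t) and t / (s + t). *)
Lemma gauge_subadditive v w : gauge U (v + w) <= gauge U v + gauge U w.
Proof.
rewrite -lerBlDr; apply: (lb_le_inf (gset_neq0 v)) => s [s0 Us].
rewrite lerBlDr (addrC s) -lerBlDr.
apply: (lb_le_inf (gset_neq0 w)) => t [t0 Ut].
rewrite lerBlDr (addrC t); have st0 : 0 < s + t by rewrite addr_gt0.
apply: gauge_le => //.
have -> : (s + t)^-1 *: (v + w) =
    (s / (s + t)) *: (s^-1 *: v) + (1 - s / (s + t)) *: (t^-1 *: w).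
  rewrite !scalerA scalerDr; congr (_ *: _ + _ *: _); field.
    by rewrite !gt_eqF.
  by rewrite !gt_eqF.
apply: (convex_setP _).1 => //; apply/andP; split.
  by rewrite divr_ge0 ?ltW.
by rewrite ler_pdivrMr// mul1r lerDl ltW.
Qed.

Let gauge_homogeneous_le (a : R) v : 0 < a -> gauge U (a *: v) <= a * gauge U v.
Proof.
move=> a0; rewrite -ler_pdivrMl//.
apply: (lb_le_inf (gset_neq0 v)) => t [t0 Ut].
rewrite ler_pdivrMl//; apply: gauge_le; first exact: mulr_gt0.
by rewrite scalerA invfM mulrC mulrA divff ?gt_eqF// mul1r.
Qed.

Lemma gauge_homogeneous (a : R) v : 0 < a -> gauge U (a *: v) = a * gauge U v.
Proof.
move=> a0; apply/eqP; rewrite eq_le gauge_homogeneous_le//=.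
have ai0 : 0 < a^-1 by rewrite invr_gt0.
have := gauge_homogeneous_le (a *: v) ai0.
by rewrite scalerA mulVf ?gt_eqF// scale1r ler_pdivlMl.
Qed.

Lemma gauge_ge1 v : ~ U v -> 1 <= gauge U v.
Proof.
move=> nUv; apply: (lb_le_inf (gset_neq0 v)) => t [t0 Ut].
rewrite leNgt; apply/negP => t1.
apply: nUv.
have -> : v = t *: (t^-1 *: v) + (1 - t) *: 0.
  by rewrite scaler0 addr0 scalerA divff ?gt_eqF// scale1r.
by apply: (convex_setP _).1 => //; [exact: nbhs_singleton|rewrite !ltW].
Qed.

End gauge.

(** The part of the bipolar theorem that is needed: W has its bipolar inside V.
    The functional comes from the gauge of a convex neighbourhood U inside V,
    which is at least 1 off U; intersecting U with - U turns the one-sided bound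
    on U into a bound on the absolute value. *)
Lemma locally_convex_separation V : nbhs 0 V ->
  exists2 W, nbhs 0 W & forall w, ~ V w ->
    exists u : {linear E -> R^o}, (forall v, W v -> `|u v| <= 1) /\ 1 <= u w.
Proof.
move=> V0; have [B Bcvx [Bopen Bbasis]] := @locally_convex R E.
have [U [BU U0] UV] := Bbasis 0 V V0.
have Un : nbhs 0 U by apply: open_nbhs_nbhs; split=> //; exact: Bopen.
have Ucvx : convex_set U by apply: Bcvx; exact: mem_set.
exists (U `&` -%R @` U); first by apply: filterI => //; exact: nbhs0N.
move=> w nVw.
have [u [ule uw]] := Hahn_Banach (gauge_subadditive Un Ucvx)
  (gauge_homogeneous Un) w.
exists u; split; last by rewrite uw; apply: gauge_ge1 => // /UV.
have uU v : U v -> u v <= 1.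
  move=> Uv; apply: le_trans (ule _) _.
  by apply: gauge_le => //; rewrite invr1 scale1r.
move=> v [Uv [v' Uv' v'v]]; rewrite ler_norml uU// andbT.
by rewrite -v'v raddfN lerN2 uU.
Qed.

Lemma nbhs0_translate V v : nbhs v V -> nbhs 0 [set w | V (v + w)].
Proof.
move=> vV; have := nbhsB (- v) vV; rewrite addNr.
by apply: filterS => _ [w Vw <-]; rewrite /= addrA subrr add0r.
Qed.

Lemma bounded_functional_continuous W (u : {linear E -> R^o}) :
  nbhs 0 W -> (forall v, W v -> `|u v| <= 1) -> continuous (u : E -> R).
Proof.
move=> W0 uW v; apply/cvgrPdist_le => /= e e0.
have := nbhsT v (nbhs0Z (lt0r_neq0 e0) W0).
apply: filterS => _ [_ [y Wy <-] <-] /=.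
have uD : u (v + e *: y) = u v + e * u y by rewrite linearD linearZ.
rewrite [X in u v - X]uD opprD addrA subrr sub0r normrN normrM gtr0_norm//.
by rewrite -[leRHS]mulr1 ler_pM2l// uW.
Qed.

(** Otherwise [locally_convex_separation], applied to a neighbourhood of 0 that
    avoids v - w, yields a continuous functional not vanishing at v - w. *)
Lemma functional_separation : hausdorff_space E -> forall v w,
  (forall u : {linear E -> R^o}, continuous (u : E -> R) -> u v = u w) -> v = w.
Proof.
move=> hE v w uvw; apply: hE => U V Uv Vw; apply: contrapT => UV0.
have [W W0 Wsep] := locally_convex_separation (nbhs0_translate Vw).
have [|u [uW]] := Wsep (v - w).
  rewrite /= addrC subrK => Vv; apply: UV0; exists v; split=> //.
  exact: nbhs_singleton.
rewrite linearB (uvw u); last exact: bounded_functional_continuous uW.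
by rewrite subrr ler10.
Qed.

End LocallyConvexSeparation.

(** * Equicontinuous pointwise bounded sets *)

Section EquicontinuousPointwiseBounded.
Context (X : topologicalType) (R : realType).
Implicit Types A B : set (Cp X R).
Local Notation EPB := (@equicontinuous_pointwise_bounded X R).

Lemma equicontinuous_pointwise_boundedP A : EPB A <->
  (forall x (e : R), 0 < e ->
     \forall y \near x, forall f, A f -> `|f x - f y| <= e) /\
  (forall x, exists M : R, forall f, A f -> `|f x| <= M).
Proof.
split=> -[Aeq Abd]; split.
- move=> x e e0.
  have := Aeq x [set ab | ball ab.1 e ab.2] (entourage_ball _ (PosNum e0)).
  apply: filterS => y Ay f Af; apply: ltW.
  by have := Ay f Af; rewrite /= -ball_normE.
- move=> x; have [M [_ AM]] := Abd x; exists (M + 1) => f Af.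
  by apply: (AM (M + 1)); [rewrite ltrDl|exists f].
- move=> x E /=; rewrite -entourage_ballE => -[e /= e0 eE].
  have e20 : 0 < e / 2 by rewrite divr_gt0.
  apply: filterS (Aeq x _ e20) => y Ay f Af; apply: eE => /=.
  rewrite -ball_normE /=; apply: le_lt_trans (Ay f Af) _.
  by rewrite ltr_pdivrMr// ltr_pMr// ltr1n.
- move=> x; have [M AM] := Abd x; exists M; split; first exact: num_real.
  move=> N MN _ [f Af <-]; exact: le_trans (AM f Af) (ltW MN).
Qed.

Lemma equicontinuous_pointwise_boundedU A B : EPB A -> EPB B -> EPB (A `|` B).
Proof.
move=> /equicontinuous_pointwise_boundedP[Aeq Abd].
move=> /equicontinuous_pointwise_boundedP[Beq Bbd].
apply/equicontinuous_pointwise_boundedP; split.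
  move=> x e e0; near=> y => f [Af|Bf].
    by move: f Af; near: y; exact: Aeq.
  by move: f Bf; near: y; exact: Beq.
move=> x; have [M AM] := Abd x; have [N BN] := Bbd x.
by exists (Num.max M N) => f [/AM|/BN]; rewrite le_max => ->; rewrite ?orbT.
Unshelve. all: by end_near. Qed.

Lemma equicontinuous_pointwise_bounded0 : EPB set0.
Proof.
apply/equicontinuous_pointwise_boundedP; split; last by move=> x; exists 0.
by move=> x e e0; apply: nearW.
Qed.

Lemma Cp_continuous (f : Cp X R) : continuous f.
Proof. exact: (@cts_fun _ _ (f : continuousType X R)). Qed.

Lemma equicontinuous_pointwise_bounded1 (f : Cp X R) : EPB [set f].
Proof.
apply/equicontinuous_pointwise_boundedP; split; last first.
  by move=> x; exists `|f x| => _ ->.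
move=> x e e0; have /cvgrPdist_le/(_ e e0) := @Cp_continuous f x.
by apply: filterS => y fy _ ->.
Qed.

End EquicontinuousPointwiseBounded.

(** * The span of the point evaluations *)

Section PointSpan.
Context (X : topologicalType) (R : realType).

Definition point_combination (s : seq (R * X)) : Cp X R -> R^o :=
  fun f => \sum_(p <- s) p.1 * f p.2.

(** Membership is a boolean predicate so that the subtype inherits its choice and
   module structures from the functions on [Cp X R]. *)
Definition is_point_combination : {pred Cp X R -> R^o} :=
  fun m => `[< exists s, m = point_combination s >].

Record point_span := PointSpan {
  point_span_val :> Cp X R -> R^o;
  point_span_valP : point_span_val \in is_point_combination }.

HB.instance Definition _ := [isSub for point_span_val].
HB.instance Definition _ := [Choice of point_span by <:].

Lemma point_combination_cat s t :
  point_combination (s ++ t) = point_combination s + point_combination t.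
Proof. by apply/funext => f; rewrite /point_combination big_cat. Qed.

Lemma point_combination_scale (a : R) s :
  point_combination [seq (a * p.1, p.2) | p <- s] = a *: point_combination s.
Proof.
apply/funext => f; rewrite /point_combination big_map.
rewrite scalrfctE /GRing.scale/= mulr_sumr.
by apply: eq_bigr => p _; rewrite mulrA.
Qed.

Fact is_point_combination_submod : submod_closed is_point_combination.
Proof.
split.
  apply/asboolP; exists [::].
  by apply/funext => f; rewrite /point_combination big_nil.
move=> a _ _ /asboolP[s ->] /asboolP[t ->]; apply/asboolP.
exists ([seq (a * p.1, p.2) | p <- s] ++ t).
by rewrite point_combination_cat point_combination_scale.
Qed.

HB.instance Definition _ := GRing.isSubmodClosed.Build R (Cp X R -> R^o)
  is_point_combination is_point_combination_submod.
HB.instance Definition _ := [SubChoice_isSubLmodule of point_span by <:].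

Implicit Types (mu nu : point_span) (f g : Cp X R) (A : set (Cp X R)).

Lemma point_spanP mu nu : mu =1 nu -> mu = nu.
Proof. by move=> munu; apply: val_inj; exact/funext. Qed.

Lemma point_spanD mu nu f : (mu + nu) f = mu f + nu f. Proof. by []. Qed.
Lemma point_spanZ (a : R) mu f : (a *: mu) f = a * mu f. Proof. by []. Qed.

Lemma point_span_combination mu :
  exists s : seq (R * X), forall f, mu f = \sum_(p <- s) p.1 * f p.2.
Proof.
by have /asboolP[s mus] := point_span_valP mu; exists s => f; rewrite mus.
Qed.

(** Finiteness of the seminorms sup over A of |mu f|, without which scalar
    multiplication would not be continuous. *)
Lemma point_span_bounded mu A : equicontinuous_pointwise_bounded A ->
  exists2 M : R, 0 < M & forall f, A f -> `|mu f| <= M.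
Proof.
move=> /equicontinuous_pointwise_boundedP[_ Abd].
have [s mus] := point_span_combination mu.
suff [M M0 sM] : exists2 M : R, 0 < M &
    forall f, A f -> `|\sum_(p <- s) p.1 * f p.2| <= M.
  by exists M => // f Af; rewrite mus; exact: sM.
elim: s {mus} => [|[a x] s [M M0 sM]].
  by exists 1 => // f _; rewrite big_nil normr0.
have [N xN] := Abd x; exists (`|a| * `|N| + M).
  by rewrite ltr_wpDl// mulr_ge0.
move=> f Af; rewrite big_cons /= (le_trans (ler_normD _ _))// lerD ?sM//.
by rewrite normrM ler_wpM2l// (le_trans (xN f Af))// ler_norm.
Qed.

Definition uniform_ball A (e : R) mu : set point_span :=
  [set nu | forall f, A f -> `|nu f - mu f| <= e].

(** The topology of uniform convergence on EPB sets. These sets are closed under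
    finite unions, so that the balls form a neighbourhood basis. *)
Definition point_span_nbhs mu : set_system point_span :=
  [set U | exists A e, [/\ equicontinuous_pointwise_bounded A, 0 < e &
                           uniform_ball A e mu `<=` U]].

HB.instance Definition _ := hasNbhs.Build point_span point_span_nbhs.

Fact point_span_nbhs_filter mu : ProperFilter (nbhs mu).
Proof.
split.
  move=> [A [e [_ e0 /(_ mu)]]]; apply=> f _.
  by rewrite subrr normr0 ltW.
split.
- by exists set0, 1; split=> //; exact: equicontinuous_pointwise_bounded0.
- move=> U V [A [d [eA d0 AU]]] [B [e [eB e0 BV]]].
  exists (A `|` B), (Num.min d e); split.
  + exact: equicontinuous_pointwise_boundedU.
  + by rewrite lt_min d0.
  + move=> nu ABnu; split; [apply: AU|apply: BV] => f ABf.
      by apply: le_trans (ABnu f (or_introl ABf)) _; rewrite ge_min lexx.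
    by apply: le_trans (ABnu f (or_intror ABf)) _; rewrite ge_min lexx orbT.
- move=> U V UV [A [e [eA e0 AU]]]; exists A, e; split=> //.
  exact: subset_trans UV.
Qed.

Fact point_span_nbhs_singleton mu (U : set point_span) : nbhs mu U -> U mu.
Proof.
move=> [A [e [_ e0]]]; apply=> f _.
by rewrite subrr normr0 ltW.
Qed.

Fact point_span_nbhs_nbhs mu (U : set point_span) :
  nbhs mu U -> nbhs mu (nbhs^~ U).
Proof.
move=> [A [e [eA e0 AU]]]; exists A, (e / 2); split=> //.
  by rewrite divr_gt0.
move=> nu numu; exists A, (e / 2); split=> //; first by rewrite divr_gt0.
move=> xi xinu; apply: AU => f Af.
have := numu f Af; have := xinu f Af; rewrite !ler_norml.
by move=> /andP[? ?] /andP[? ?]; apply/andP; split; lra.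
Qed.

HB.instance Definition _ := Nbhs_isNbhsTopological.Build point_span
  point_span_nbhs_filter point_span_nbhs_singleton point_span_nbhs_nbhs.

Fact point_span_add_continuous :
  continuous (fun z : point_span * point_span => z.1 + z.2).
Proof.
move=> [mu nu] U [A [e [eA e0 AU]]] /=.
exists (uniform_ball A (e / 2) mu, uniform_ball A (e / 2) nu) => /=.
  by split; exists A, (e / 2); split=> //; rewrite divr_gt0.
move=> [mu' nu'] /= [mumu nunu]; apply: AU => f Af.
have := mumu f Af; have := nunu f Af; rewrite !point_spanD !ler_norml.
by move=> /andP[? ?] /andP[? ?]; apply/andP; split; lra.
Qed.

Fact point_span_scale_continuous :
  continuous (fun z : R^o * point_span => z.1 *: z.2).
Proof.
move=> [a mu] U [A [e [eA e0 AU]]] /=.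
have [M M0 muM] := point_span_bounded mu eA.
(* b nu - a mu = b (nu - mu) + (b - a) mu: the radius d handles the first term
   for |b| <= |a| + 1, and |b - a| <= c handles the second. *)
pose d := e / 2 / (`|a| + 1).
have a10 : 0 < `|a| + 1 by rewrite ltr_wpDl.
have d0 : 0 < d by rewrite !divr_gt0.
pose c := Num.min 1 (e / 2 / M).
have c0 : 0 < c by rewrite lt_min ltr01 !divr_gt0.
exists (ball (a : R^o) c, uniform_ball A d mu) => /=.
  by split; [exact: nbhsx_ballx|exists A, d; split].
move=> [b nu] /= []; rewrite -ball_normE/= => /ltW ab munu; apply: AU => f Af.
rewrite !point_spanZ.
have -> : b * nu f - a * mu f = b * (nu f - mu f) + (b - a) * mu f by ring.
have b1 : `|b| <= `|a| + 1.
  have -> : b = a - (a - b) by ring.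
  rewrite (le_trans (ler_normB _ _))// lerD2l (le_trans ab)//.
  by rewrite ge_min lexx.
rewrite (le_trans (ler_normD _ _))// [leRHS](splitr e) lerD// normrM.
  apply: le_trans (ler_pM _ _ b1 (munu f Af)) _ => //.
  by rewrite /d mulrC divfK ?gt_eqF.
rewrite distrC; apply: le_trans (ler_pM _ _ ab (muM f Af)) _ => //.
rewrite -ler_pdivlMr//.
by rewrite ge_min lexx orbT.
Qed.

Fact point_span_locally_convex : exists2 B : set_system point_span,
  (forall b, b \in B -> convex_set b) & basis B.
Proof.
(* Unions of the balls of radius r < e, which are open, unlike those balls. *)
exists [set U | exists mu A e, equicontinuous_pointwise_bounded A /\
  U = [set nu | exists2 r, r < e & uniform_ball A r mu nu]].
  move=> _ /set_mem[mu [A [e [eA ->]]]].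
  apply/convex_setP => nu xi t [r re nur] [s se xis] /andP[t0].
  rewrite -subr_ge0 => t1.
  exists (Num.max r s) => [|f Af]; first by rewrite gt_max re.
  have -> : (t *: nu + (1 - t) *: xi) f - mu f =
      t * (nu f - mu f) + (1 - t) * (xi f - mu f).
    by rewrite point_spanD !point_spanZ; ring.
  rewrite (le_trans (ler_normD _ _))//.
  have -> : Num.max r s = t * Num.max r s + (1 - t) * Num.max r s by ring.
  rewrite !normrM (ger0_norm t0) (ger0_norm t1) lerD// ler_wpM2l//.
    by rewrite le_max nur.
  by rewrite le_max xis// orbT.
split.
  move=> _ [mu [A [e [eA ->]]]]; rewrite openE => nu [r re nur].
  exists A, ((e - r) / 2); split=> //; first by rewrite divr_gt0// subr_gt0.
  move=> xi xinu; exists ((e + r) / 2).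
    by rewrite ltr_pdivrMr//; lra.
  move=> f Af; have := nur f Af; have := xinu f Af; rewrite !ler_norml.
  by move=> /andP[? ?] /andP[? ?]; apply/andP; split; lra.
move=> mu U [A [e [eA e0 AU]]].
exists [set nu | exists2 r, r < e & uniform_ball A r mu nu]; last first.
  move=> nu [r re nur]; apply: AU => f Af; exact: le_trans (nur f Af) (ltW re).
split; first by exists mu, A, e.
by exists 0 => // f _; rewrite subrr normr0.
Qed.

HB.instance Definition _ := PreTopologicalLmod_isTvs.Build R point_span
  point_span_add_continuous point_span_scale_continuous
  point_span_locally_convex.
HB.instance Definition _ := PreTopologicalNmodule_isTopologicalNmodule.Build
  point_span point_span_add_continuous.
HB.instance Definition _ := TopologicalNmodule_isTopologicalLmodule.Build R
  point_span point_span_scale_continuous.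
HB.instance Definition _ := Uniform_isTvs.Build R point_span
  point_span_locally_convex.

End PointSpan.

(** * Freeness of the span of the evaluations *)

Lemma spanned_linear_eq (R : realType) (T : Type) (L E : lmodType R)
    (d : T -> L) (g h : L -> E) :
  (forall v, exists s : seq (R * T), v = \sum_(p <- s) p.1 *: d p.2) ->
  linear g -> linear h -> (forall x, g (d x) = h (d x)) -> g = h.
Proof.
move=> dspan glin hlin gh; apply/funext => v; have [s ->] := dspan v.
have g0 : g 0 = 0.
  by have := glin (-1) 0 0; rewrite scaler0 addr0 scaleN1r addNr.
have h0 : h 0 = 0.
  by have := hlin (-1) 0 0; rewrite scaler0 addr0 scaleN1r addNr.
elim: s => [|p s IHs]; first by rewrite big_nil g0 h0.
by rewrite big_cons glin hlin gh IHs.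
Qed.

Section PointSpanFree.
Context (X : topologicalType) (R : realType).
Local Notation L := (point_span X R).
Implicit Types (mu nu : L) (x : X).

Lemma evaluation_in_point_span x :
  (point_combination [:: (1, x)] : Cp X R -> R^o) \in @is_point_combination X R.
Proof. by apply/asboolP; eexists. Qed.

Definition evaluation x : L := PointSpan (evaluation_in_point_span x).

Lemma evaluationE x (f : Cp X R) : evaluation x f = f x.
Proof. by rewrite /= /point_combination big_seq1 mul1r. Qed.

Lemma point_span_sum I (s : seq I) (F : I -> L) (f : Cp X R) :
  (\sum_(i <- s) F i) f = \sum_(i <- s) F i f.
Proof. by elim/big_ind2 : _ => // [a b c d <- <-]. Qed.

Lemma point_span_evaluation mu :
  exists s : seq (R * X), mu = \sum_(p <- s) p.1 *: evaluation p.2.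
Proof.
have [s mus] := point_span_combination mu; exists s; apply: point_spanP => f.
rewrite mus point_span_sum; apply: eq_bigr => p _.
by rewrite point_spanZ evaluationE.
Qed.

(** Singletons are EPB sets, so distinct functionals are separated by their
    values at one function. *)
Lemma point_span_hausdorff : hausdorff_space L.
Proof.
move=> mu nu munu; apply: point_spanP => f; apply/eqP; apply: contrapT => /negP.
rewrite -subr_eq0 -normr_gt0 => e0.
set e := `|mu f - nu f| in e0.
have f1 := equicontinuous_pointwise_bounded1 f.
have ball_nbhs xi : nbhs xi (uniform_ball [set f] (e / 3) xi).
  by exists [set f], (e / 3); split=> //; rewrite divr_gt0.
have [xi [/(_ f erefl) ximu /(_ f erefl) xinu]] :=
  munu _ _ (ball_nbhs mu) (ball_nbhs nu).
have : e <= `|xi f - mu f| + `|xi f - nu f|.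
  have munuE : mu f - nu f = (mu f - xi f) + (xi f - nu f) by ring.
  rewrite (distrC (xi f)) /e munuE.
  exact: ler_normD.
lra.
Qed.

Lemma evaluation_continuous : continuous evaluation.
Proof.
move=> x U [A [e [eA e0 AU]]].
have [Aeq _] := (equicontinuous_pointwise_boundedP A).1 eA.
apply: filterS (Aeq x e e0) => y Ay; apply: AU => f Af.
by rewrite !evaluationE distrC; exact: Ay.
Qed.

Lemma evaluation_injective : tychonoff_space X -> injective evaluation.
Proof.
move=> [crX hX] x y exy; apply: contrapT => xy.
have cly : closed [set y].
  by apply: accessible_closed_set1; exact: hausdorff_accessible.
have sep := crX x [set y] cly xy.
pose f := (Urysohn [set x] [set y] : X -> R).
have fc : continuous f by exact: Urysohn_continuous.
have : f x = f y.
  by have := congr1 (fun mu : L => mu (Cp_mk fc)) exy; rewrite !evaluationE.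
have fx : f x = 0 by apply: (Urysohn_sub0 (R := R) sep); exists x.
have fy : f y = 1 by apply: (Urysohn_sub1 (R := R) sep); exists y.
by rewrite fx fy => /eqP; rewrite eq_sym oner_eq0.
Qed.

Section universal_property.
Context (E : tvsType R) (hE : hausdorff_space E).
Context (f : X -> E) (fc : continuous f).

(** The value is computed from a chosen representation of mu; that it does not
    depend on the choice follows from [functional_extension]. *)
Definition point_span_extension mu : E :=
  \sum_(p <- sval (cid (point_span_combination mu))) p.1 *: f p.2.

Let g := point_span_extension.

Lemma functional_extension (u : {linear E -> R^o}) (h : Cp X R) mu :
  h =1 u \o f -> u (g mu) = mu h.
Proof.
move=> hu; rewrite /g /point_span_extension; case: cid => s /= ->.
rewrite linear_sum; apply: eq_bigr => p _.
by rewrite linearZ hu.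
Qed.

Lemma functional_comp (u : {linear E -> R^o}) : continuous (u : E -> R) ->
  exists h : Cp X R, h =1 u \o f.
Proof.
move=> uc; have ufc : continuous ((u : E -> R) \o f).
  by move=> x; apply: continuous_comp; [exact: fc|exact: uc].
by exists (Cp_mk ufc).
Qed.

Lemma point_span_extension_linear : linear g.
Proof.
move=> a mu nu; apply: functional_separation hE _ _ _ => u uc.
have [h hu] := functional_comp uc.
by rewrite linearP !(functional_extension _ hu) point_spanD point_spanZ.
Qed.

Lemma point_span_extension_evaluation : f = g \o evaluation.
Proof.
apply/funext => x; apply: functional_separation hE _ _ _ => u uc.
have [h hu] := functional_comp uc.
by rewrite /= (functional_extension _ hu) evaluationE hu.
Qed.

(** The functions u o f for u in the polar of W. *)
Definition functional_pullback (W : set E) : set (Cp X R) :=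
  [set h : Cp X R | exists u : {linear E -> R^o},
    (forall v, W v -> `|u v| <= 1) /\ h =1 u \o f].

(** Equicontinuity: u moves by at most e on f x + e W, uniformly in u, and f is
    continuous. Boundedness at x: W absorbs f x. *)
Lemma functional_pullback_bounded (W : set E) : nbhs 0 W ->
  equicontinuous_pointwise_bounded (functional_pullback W).
Proof.
move=> W0; apply/equicontinuous_pointwise_boundedP; split.
  move=> x e e0.
  have fW := nbhsT (f x) (nbhs0Z (lt0r_neq0 e0) W0).
  have fxW : nbhs x (f @^-1` (+%R (f x) @` ( *:%R e @` W))) := fc fW.
  apply: filterS fxW => y [_ [v Wv <-] fy] h [u [uW hu]]; rewrite !hu /= -fy.

  have uD : u (f x + e *: v) = u (f x) + e * u v by rewrite linearD linearZ.
  rewrite [X in _ - X]uD opprD addrA subrr sub0r normrN normrM gtr0_norm//.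
  by rewrite -[leRHS]mulr1 ler_pM2l// uW.
move=> x; have [t t0 Wt] := nbhs0_absorbing (f x) W0; exists t => h [u [uW hu]].
rewrite hu /=; have := uW _ Wt.
by rewrite linearZ /= normrM gtr0_norm ?invr_gt0// ler_pdivrMl// mulr1.
Qed.

(** If nu is within 1/2 of mu on the pullback of the polar of W, no functional
    of that polar reaches 1 at g nu - g mu, so g nu lies in g mu + V. *)
Lemma point_span_extension_continuous : continuous g.
Proof.
have glin := point_span_extension_linear.
move=> mu V gV.
have [W W0 Wsep] := locally_convex_separation (nbhs0_translate gV).
exists (functional_pullback W), (1 / 2); split=> //.
  exact: functional_pullback_bounded.
move=> nu munu; apply: contrapT => nV.
have gnu : g nu = g mu + (g nu - g mu) by rewrite addrC subrK.
have [|u [uW u1]] := Wsep (g nu - g mu); first by rewrite /= -gnu.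
have [h hu] := functional_comp (bounded_functional_continuous W0 uW).
have uh : functional_pullback W h by exists u.
have := munu h uh; rewrite -!(functional_extension _ hu).
have -> : u (g nu) - u (g mu) = u (g nu - g mu) by rewrite linearB.
move=> /(le_trans (ler_norm _)) /(le_trans u1); lra.
Qed.

End universal_property.

Theorem point_span_free :
  tychonoff_space X -> free_locally_convex_space evaluation.
Proof.
move=> tX; split.
- exact: point_span_hausdorff.
- exact: evaluation_continuous.
- exact: evaluation_injective.
- exact: point_span_evaluation.
- move=> E f hE fc; exists (point_span_extension f); split.
    split; first exact: point_span_extension_linear.
      exact: point_span_extension_continuous.
    exact: point_span_extension_evaluation.
  move=> g [glin _ fg]; apply: (spanned_linear_eq point_span_evaluation) => //.
    exact: point_span_extension_linear.
  by move=> x; have := congr1 (@^~ x) fg; rewrite /= => <-;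
    rewrite [in RHS](point_span_extension_evaluation hE fc).
Qed.

End PointSpanFree.

(** * The dual of the space of continuous functions *)

(** Induction on s. If l i vanishes on the common kernel K of the others, it can
    be dropped. Otherwise pick z in K with l i z != 0: subtracting from u the
    multiple of l i that agrees with u at z gives a functional vanishing on K,
    since every v in K differs by a multiple of z from a vector of K killed by
    l i. *)
Lemma kernel_combination (R : realType) (V : lmodType R) (I : Type)
    (l : I -> V -> R) (s : seq I) (u : V -> R) :
  (forall i, linear (l i : V -> R^o)) -> linear (u : V -> R^o) ->
  (forall v, all (fun i => l i v == 0) s -> u v = 0) ->
  exists t : seq (R * I), forall v, u v = \sum_(p <- t) p.1 * l p.2 v.
Proof.
move=> llin; elim: s u => [|i s IHs] u ulin uker.
  by exists [::] => v; rewrite big_nil uker.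
have [[z sz liz]|lK] := pselect
    (exists2 z, all (fun j => l j z == 0) s & l i z != 0); last first.
  apply: IHs => // v sv; apply: uker; rewrite /= sv andbT.
  by apply: contrapT => /negP liv; apply: lK; exists v.
pose c := u z / l i z.
have ulin' : linear ((fun v => u v - c * l i v) : V -> R^o).
  move=> a v w; rewrite (ulin a v w) (llin i a v w) /GRing.scale/=.
  by ring.
have [v sv|t ut] := IHs _ ulin'; last first.
  by exists ((c, i) :: t) => v; rewrite big_cons /= -ut addrC subrK.
pose b := l i v / l i z.
have : u (- b *: z + v) = 0.
  apply: uker; rewrite /= (llin i) /GRing.scale/=; apply/andP; split.
    by rewrite /b mulNr divfK// addNr.
  have : all (predI (fun j => l j z == 0) (fun j => l j v == 0)) s.
    by rewrite all_predI sz sv.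
  apply: sub_all => j /= /andP[/eqP zj /eqP vj].
  by rewrite (llin j) zj vj /GRing.scale/= mulr0 addr0.
rewrite (ulin (- b)) /GRing.scale/= => uv.
by rewrite /c mulrAC -mulrA -/b; lra.
Qed.

Section PointwiseConvergence.
Context (X : topologicalType) (R : realType).
Implicit Types (f : Cp X R) (mu : point_span X R).

Lemma Cp_cvgP (F : set_system (Cp X R)) f : Filter F ->
  F --> f <-> forall x, (fun g : Cp X R => g x) @ F --> f x.
Proof.
move=> FF; split=> [Ff x|Fx].
  have /pointwise_cvgP : {ptws, (@Cp_fun X R) @ F --> Cp_fun f}.
    apply: cvg_comp Ff _.
    exact: (@initial_continuous (Cp X R) {ptws X -> R} (@Cp_fun X R) f).
  exact.
have Fp : {ptws, (@Cp_fun X R) @ F --> Cp_fun f} by apply/pointwise_cvgP.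
move=> U [_ /= [[W oW <-]]] Wf /filterS; apply.
by apply: Fp; exact: open_nbhs_nbhs.
Qed.

Lemma point_span_linear mu : linear (mu : Cp X R -> R^o).
Proof.
move=> a f g; have [s mus] := point_span_combination mu.
rewrite !mus /GRing.scale/= mulr_sumr -big_split/=; apply: eq_bigr => p _.
by rewrite mulrDr mulrCA.
Qed.

Lemma point_span_continuous mu : continuous (mu : Cp X R -> R).
Proof.
move=> f; have [s mus] := point_span_combination mu.
have -> : (mu : Cp X R -> R) = fun g => \sum_(p <- s) p.1 * g p.2.
  exact/funext.
elim: s {mus} => [|p s IHs].
  rewrite (_ : (fun _ => _) = cst 0); first exact: cst_continuous.
  by apply/funext => g; rewrite big_nil.
rewrite (_ : (fun _ => _) =
    (fun g : Cp X R => p.1 * g p.2 + \sum_(p <- s) p.1 * g p.2)); last first.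
  by apply/funext => g; rewrite big_cons.
have pf : (fun g : Cp X R => g p.2) @ nbhs f --> f p.2.
  by have /Cp_cvgP := @cvg_id _ (nbhs f); exact.
exact: (cvgD (cvgMl_tmp (a := p.1) pf) IHs).
Qed.

Let small (s : seq X) (e : R) : set (Cp X R) :=
  [set f : Cp X R | all (fun x => `|f x| <= e) s].

(** The filter F generated by the sets of functions small on a finite set
    converges to 0 pointwise, hence u is less than 1 on some member of F. If f
    vanishes on the corresponding finite set s, then so does every multiple of
    f, which forces u f = 0; so [kernel_combination] applies to the evaluations
    at the points of s. *)
Lemma continuous_functional_combination (u : {linear Cp X R -> R^o}) :
  continuous (u : Cp X R -> R) ->
  (u : Cp X R -> R^o) \in @is_point_combination X R.
Proof.
move=> uc.
pose F : set_system (Cp X R) := [set U | exists s e, 0 < e /\ small s e `<=` U].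
have FF : Filter F.
  split.
  - by exists [::], 1.
  - move=> U V [s [d [d0 sU]]] [t [e [e0 tV]]].
    exists (s ++ t), (Num.min d e); rewrite lt_min d0; split=> // f.
    rewrite /small/= all_cat => /andP[sf tf]; split; [apply: sU|apply: tV].
      by apply: sub_all sf => x; rewrite le_min => /andP[].
    by apply: sub_all tf => x; rewrite le_min => /andP[].
  - move=> U V UV [s [e [e0 sU]]]; exists s, e; split=> //.
    exact: subset_trans UV.
have F0 : F --> (0 : Cp X R).
  apply/Cp_cvgP => x; apply/cvgrPdist_le => e e0.
  exists [:: x], e; split=> // f.
  by rewrite /small /= andbT distrC subr0.
have /cvgrPdist_lt/(_ 1 ltr01)[s [e [e0 su]]] : u @ F --> (0 : R).
  by rewrite -[X in _ --> X](linear0 u); apply: cvg_comp F0 _; exact: uc.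
have [||f sf|t ut] := @kernel_combination R (Cp X R) X (fun x f => f x) s u.
- by [].
- exact: linearP.
- apply: contrapT => /eqP uf.
  pose f1 := ((u f : R)^-1 : R) *: f.
  have uf1 : u f1 = 1 by rewrite linearZ; exact: (@mulVf R).
  suff /su /= : small s e f1 by rewrite uf1 sub0r normrN normr1 ltxx.
  rewrite /small /=; apply: sub_all sf => x /eqP /= fx.
  have -> : f1 x = (u f : R)^-1 * f x by [].
  by rewrite [f x]fx mulr0 normr0 ltW.
- by apply/asboolP; exists t; apply/funext.
Qed.

End PointwiseConvergence.

(** * From function spaces to free spaces *)

Section Transpose.
Context (R : realType) (X Y : topologicalType).
Context (phi : {linear Cp Y R -> Cp X R}) (phic : continuous phi).

Lemma transpose_in_point_span (mu : point_span X R) :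
  ((mu : Cp X R -> R^o) \o phi) \in @is_point_combination Y R.
Proof.
have mulin : linear ((mu : Cp X R -> R^o) \o phi).
  by move=> a f g; rewrite /= linearP point_span_linear.
pose u : {linear Cp Y R -> R^o} := HB.pack_for {linear Cp Y R -> R^o}
  ((mu : Cp X R -> R^o) \o phi) (GRing.isLinear.Build _ _ _ _ _ mulin).
apply: (@continuous_functional_combination _ _ u).
move=> f; apply: continuous_comp; first exact: phic.
exact: point_span_continuous.
Qed.

Definition transpose (mu : point_span X R) : point_span Y R :=
  PointSpan (transpose_in_point_span mu).

Fact transpose_linear : linear transpose.
Proof. by move=> a mu nu; apply: point_spanP => f. Qed.

HB.instance Definition _ :=
  GRing.isLinear.Build _ _ _ _ transpose transpose_linear.

(** The transpose maps the ball given by phi A into the ball given by A. *)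
Lemma transpose_continuous :
  preserves_equicontinuous_pointwise_bounded phi -> continuous transpose.
Proof.
move=> phiE mu U [A [e [eA e0 AU]]].
exists (phi @` A), e; split=> //; first exact: phiE.
by move=> nu munu; apply: AU => f Af; apply: munu; exists f.
Qed.

End Transpose.

(** * From free spaces to function spaces *)

Section InducedMap.
Context (R : realType) (X Y : topologicalType).
Context (k : Y -> point_span X R) (kc : continuous k).

Lemma point_span_at_continuous (f : Cp X R) :
  continuous (fun mu : point_span X R => mu f).
Proof.
move=> mu U /nbhs_ballP[e /= e0 eU].
exists [set f], (e / 2); split; first exact: equicontinuous_pointwise_bounded1.
  by rewrite divr_gt0.
move=> nu /(_ f erefl) numu; apply: eU; rewrite -ball_normE /= distrC.
by apply: le_lt_trans numu _; rewrite ltr_pdivrMr// ltr_pMr// ltr1n.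
Qed.

Lemma induced_map_subproof (f : Cp X R) : continuous (fun y => k y f).
Proof.
move=> y; apply: (@continuous_comp _ _ _ k (fun mu : point_span X R => mu f)).
  exact: kc.
exact: point_span_at_continuous.
Qed.

Definition induced_map (f : Cp X R) : Cp Y R := Cp_mk (@induced_map_subproof f).

Fact induced_map_linear : linear induced_map.
Proof. by move=> a f g; apply: CpP => y; exact: point_span_linear. Qed.

HB.instance Definition _ :=
  GRing.isLinear.Build _ _ _ _ induced_map induced_map_linear.

Lemma induced_map_continuous : continuous induced_map.
Proof.
move=> f; have ff : Filter (induced_map @ nbhs f) by exact: fmap_filter.
apply/Cp_cvgP => y; exact: point_span_continuous.
Qed.

(** The ball around k y given by A and e pulls back under k to a neighbourhood
    of y on which all functions of the image of A vary by at most e. *)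
Lemma induced_map_bounded :
  preserves_equicontinuous_pointwise_bounded induced_map.
Proof.
move=> A eA; apply/equicontinuous_pointwise_boundedP; split.
  move=> y e e0.
  have ky : nbhs (k y) (uniform_ball A e (k y)).
    by exists A, e; split=> //; exact: subset_refl.
  have : nbhs y (k @^-1` uniform_ball A e (k y)) := kc ky.
  apply: filterS => z yz _ [f Af <-].
  by rewrite distrC; exact: yz.
move=> y; have [M _ AM] := point_span_bounded (k y) eA.
by exists M => _ [f Af <-]; exact: AM.
Qed.

End InducedMap.

Section FreeSpaceIsomorphism.
Context (R : realType).

Lemma free_to_point_span (X : topologicalType) (L : tvsType R) (d : X -> L) :
  free_locally_convex_space d -> exists g : {linear L -> point_span X R},
    continuous g /\ forall x, g (d x) = evaluation R x.
Proof.
move=> [_ _ _ _ Luniv].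
have [g [[glin gc dg] _]] :=
  Luniv _ _ (@point_span_hausdorff X R) (@evaluation_continuous X R).
exists (HB.pack_for {linear L -> point_span X R} g
  (GRing.isLinear.Build _ _ _ _ g glin)); split=> // x.
by rewrite dg.
Qed.

(** The induced map is the transpose of psi for the pairing of a free space with
    the continuous functions. Both sides are linear in v, so it suffices to
    compare them at the generators dY y. *)
Lemma induced_map_pairing (X Y : topologicalType) (LX LY : tvsType R)
    (dY : Y -> LY) (psi : {linear LY -> LX})
    (gX : {linear LX -> point_span X R}) (gY : {linear LY -> point_span Y R})
    (kc : continuous (gX \o psi \o dY)) :
  (forall v : LY, exists s : seq (R * Y), v = \sum_(p <- s) p.1 *: dY p.2) ->
  (forall y, gY (dY y) = evaluation R y) ->
  forall v f, gY v (induced_map kc f) = gX (psi v) f.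
Proof.
move=> dYspan gYd v f.
have := @spanned_linear_eq R Y LY R^o dY (fun v => gY v (induced_map kc f))
  (fun v => gX (psi v) f) dYspan.
move=> /(_ _ _ _)/(congr1 (@^~ v)); apply.
- by move=> a v1 v2; rewrite linearP.
- by move=> a v1 v2; rewrite !linearP.
- by move=> y; rewrite gYd evaluationE.
Qed.

End FreeSpaceIsomorphism.

Theorem corollary3p7 (R : realType) (X Y : topologicalType)
    (tychX : tychonoff_space X) (tychY : tychonoff_space Y) :
  L_equivalent R X Y <->
  exists (phi : {linear Cp X R -> Cp Y R}) (psi : {linear Cp Y R -> Cp X R}),
    [/\ topological_isomorphism phi psi,
        preserves_equicontinuous_pointwise_bounded phi &
        preserves_equicontinuous_pointwise_bounded psi].
Proof.
split.
  move=> [LX [LY [dX [dY [freeX freeY [phi [psi [phiK psiK phic psic]]]]]]]].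
  have [gX [gXc gXd]] := free_to_point_span freeX.
  have [gY [gYc gYd]] := free_to_point_span freeY.
  have [_ dXc _ dXspan _] := freeX; have [_ dYc _ dYspan _] := freeY.
  have kXc : continuous (gX \o psi \o dY).
    move=> y; apply: continuous_comp; first exact: dYc.
    by apply: continuous_comp; [exact: psic|exact: gXc].
  have kYc : continuous (gY \o phi \o dX).
    move=> x; apply: continuous_comp; first exact: dXc.
    by apply: continuous_comp; [exact: phic|exact: gYc].
  have TE := induced_map_pairing kXc dYspan gYd.
  have SE := induced_map_pairing kYc dXspan gXd.
  exists (induced_map kXc), (induced_map kYc); split; first split.
  - move=> f; apply: CpP => x.
    by rewrite [LHS]TE /= phiK gXd evaluationE.
  - move=> f; apply: CpP => y.
    by rewrite [LHS]SE /= psiK gYd evaluationE.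
  - exact: induced_map_continuous.
  - exact: induced_map_continuous.
  - exact: induced_map_bounded.
  - exact: induced_map_bounded.
move=> [phi [psi [[phiK psiK phic psic] phiE psiE]]].
exists (point_span X R), (point_span Y R), (@evaluation X R), (@evaluation Y R).
split; [exact: point_span_free|exact: point_span_free|].
exists (transpose psic), (transpose phic); split.
- by move=> mu; apply: point_spanP => f; rewrite /= phiK.
- by move=> mu; apply: point_spanP => f; rewrite /= psiK.
- exact: transpose_continuous.
- exact: transpose_continuous.
Qed.
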